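(* Let $\delta\in(0,1)$ and let $\mathcal{C}$ be a class of subsets of $\{1,\ldots,n\}$, each of cardinality $K\ge1$. Let $S,S'$ be drawn independently and uniformly at random from $\mathcal{C}$, and let $Z=|S\cap S'|$. Assume that: (i) the conditional distribution of $Z$ given $S'$ is identical for all values of $S'$; (ii) for any fixed $S_0\in\mathcal{C}$ and $i\in S_0$, $\mathbb{P}\{i\in S\}=K/n$. Then $R^*_{\mathcal{C}}(\mu)\ge\delta$ for all $\mu>0$ with $$\mu\ \le\ \sqrt{\frac1K\log\left(1+\frac{4n(1-\delta)^2}{K}\right)}.$$
   Context: Setting: $\mathcal{C}=\{S_1,\ldots,S_N\}$ is a class of $N\ge 1$ distinct subsets of $\{1,\ldots,n\}$, all of the same cardinality $K$. Under $\mathbb{P}_0$, the components of the random vector $\mathbf{X}=(X_1,\ldots,X_n)$ are independent standard normal. For $S\in\mathcal{C}$, under $\mathbb{P}_S$ the components are independent with $X_i\sim\mathcal{N}(\mu,1)$ for $i\in S$ and $X_i\sim\mathcal{N}(0,1)$ for $i\notin S$, where $\mu>0$. The risk of a (measurable) test $f:\mathbb{R}^n\to\{0,1\}$ is $$R(f)=\mathbb{P}_0\{f(\mathbf{X})=1\}+\frac1N\sum_{S\in\mathcal{C}}\mathbb{P}_S\{f(\mathbf{X})=0\},$$ and $R^*=R^*_{\mathcal{C}}(\mu)$ denotes the minimum of $R(f)$ over all tests $f$. Equivalently, $R^*_{\mathcal{C}}(\mu)=1-\frac12\mathbb{E}_0|L(\mathbf{X})-1|$, where $L(\mathbf{x})=\frac1N\sum_{S\in\mathcal{C}}e^{\mu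 x_S-K\mu^2/2}$ with $x_S=\sum_{i\in S}x_i$. *)

(* Defs.v *)
From HB Require Import structures.
From mathcomp Require Import all_boot all_order all_algebra.
From mathcomp Require Import all_classical all_reals all_analysis.

Set Implicit Arguments.
Unset Strict Implicit.
Unset Printing Implicit Defensive.

Import Order.TTheory GRing.Theory Num.Theory.
Import numFieldNormedType.Exports.

Local Open Scope classical_set_scope.
Local Open Scope ring_scope.

Section product_probability.
Context d (T : measurableType d) (R : realType).

Definition tcons n (x : T * n.-tuple T) : n.+1.-tuple T :=
  [tuple of x.1 :: x.2].

Lemma measurable_tcons n : measurable_fun [set: T * n.-tuple T] (@tcons n).
Proof. by apply: measurable_cons. Qed.

HB.instance Definition _ n := isMeasurableFun.Build _ _ _ _ (@tcons n)
  (@measurable_tcons n).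

(* The product of the laws P 0, ..., P (n-1): the joint law of independent
   components with marginals P i (see product_prob_rect). *)
Fixpoint product_prob n : ('I_n -> probability T R) ->
    probability (n.-tuple T) R :=
  match n with
  | 0 => fun=> \d_[tuple]
  | n'.+1 => fun P =>
      distribution (P ord0 \x product_prob (fun i => P (lift ord0 i)))%E
        (@tcons n')
  end.

Lemma product_prob_rect n (P : 'I_n -> probability T R) (A : 'I_n -> set T) :
  (forall i, measurable (A i)) ->
  product_prob P [set x | forall i, A i (tnth x i)] =
    (\prod_(i < n) P i (A i))%E.
Proof.
elim: n P A => [|n IH] P A mA /=.
  rewrite big_ord0 diracE mem_set//=; by case.
have mrect : measurable
    [set x : n.-tuple T | forall i, A (lift ord0 i) (tnth x i)].
  rewrite (_ : [set x | _] = \big[setI/setT]_(i < n)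
      ((fun x : n.-tuple T => tnth x i) @^-1` A (lift ord0 i))).
    by apply: bigsetI_measurable => i _; rewrite -[X in measurable X]setTI;
      apply: measurable_tnth.
  rewrite -bigcap_seq; apply/seteqP; split => x /= h i.
    by move=> _; exact: h.
  by have := h i; apply; rewrite /= mem_index_enum.
rewrite big_ord_recl -(IH (fun i => P (lift ord0 i))
  (fun i => A (lift ord0 i)))//.
rewrite -product_measure1E//= /distribution /pushforward; congr (_ _).
apply/seteqP; split => [[x y] h|[x y] [h1 h2] i]/=.
  split => /=; first by have := h ord0.
  by move=> i; have := h (lift ord0 i); rewrite tnthS.
by have [j ->|->]// := unliftP ord0 i; rewrite /= tnthS.
Qed.

End product_probability.

Section finite_probability.
Context (R : realType).

Definition uniform_pmf (T : finType) (A : {set T}) (x : T) : R :=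
  if x \in A then #|A|%:R^-1 else 0.

(* Joint mass function of two independent draws, with mass functions p and q. *)
Definition indep_pmf (T U : finType) (p : T -> R) (q : U -> R)
  (xy : T * U) : R := p xy.1 * q xy.2.

Definition pmf_prob (T : finType) (p : T -> R) (E : {set T}) : R :=
  \sum_(x in E) p x.

Definition pmf_cond (T : finType) (p : T -> R) (E F : {set T}) : R :=
  pmf_prob p (E :&: F) / pmf_prob p F.

End finite_probability.

Section random_pair.
Context (R : realType) (n : nat).
Implicit Type C : {set {set 'I_n}}.

Definition pair_pmf C : {set 'I_n} * {set 'I_n} -> R :=
  indep_pmf (uniform_pmf R C) (uniform_pmf R C).

Definition overlap (p : {set 'I_n} * {set 'I_n}) : nat := #|p.1 :&: p.2|.

End random_pair.

Section testing.
Context (R : realType) (n : nat).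

(* Independent components, X_i ~ N(m i, 1). The space is R^n with its Borel
   sigma-algebra: measurableTypeR R is R, carrying the Borel structure on which
   normal_prob is defined. *)
Definition normal_law (m : 'I_n -> R) :
    probability (n.-tuple (measurableTypeR R)) R :=
  product_prob
    (fun i => normal_prob (m i) 1 : probability (measurableTypeR R) R).

Definition null_law : probability (n.-tuple (measurableTypeR R)) R :=
  normal_law (fun=> 0).

Definition planted_law (mu : R) (S : {set 'I_n}) :
    probability (n.-tuple (measurableTypeR R)) R :=
  normal_law (fun i => if i \in S then mu else 0).

(* A test is a measurable f : R^n -> {0, 1}, with true standing for 1. *)
Definition risk (C : {set {set 'I_n}}) (mu : R)
    (f : {mfun n.-tuple (measurableTypeR R) >-> bool}) : \bar R :=
  (null_law [set x | f x = true] +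
   (#|C|%:R^-1)%:E * \sum_(S in C) planted_law mu S [set x | f x = false])%E.

(* The minimum risk over all tests, written as an infimum so that the definition
   is total; the likelihood ratio test attains it. *)
Definition optimal_risk (C : {set {set 'I_n}}) (mu : R) : \bar R :=
  ereal_inf (range (risk C mu)).

End testing.

(* Main.v *)
Require Import Defs.
From mathcomp Require Import all_boot all_order all_algebra.
From mathcomp Require Import all_classical all_reals all_analysis.
From mathcomp Require Import measurable_realfun.
From mathcomp Require Import ring lra.

(** Let [L] be the likelihood ratio of the uniform mixture of the planted laws
    with respect to the null law. The risk of a test with rejection region [A]
    is [P_0 A + \int_(~` A) L], and for [t > 0] it is at least [1 - t / 2] as
    soon as [E_0 L^2 <= 1 + t^2]. The Gaussian shift identity gives
    [E_0 L^2 = E exp(mu^2 Z)]. Since [0 <= Z <= K], convexity gives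
    [E exp(mu^2 Z) <= 1 + (E Z / K) (exp(mu^2 K) - 1)], and (ii) gives
    [E Z = K^2 / n]; the bound on [mu] then allows [t = 2 (1 - delta)]. *)

Set Implicit Arguments.
Unset Strict Implicit.
Unset Printing Implicit Defensive.

Import Order.TTheory GRing.Theory Num.Theory.

Local Open Scope classical_set_scope.
Local Open Scope ring_scope.

(** * Gaussian change of measure, for one coordinate and then for product laws *)

Section change_of_measure.
Context (R : realType).
Local Notation mR := (measurableTypeR R).
Local Notation mu := (@lebesgue_measure R).
Local Notation normalP m := (normal_prob m 1 : probability mR R).

(** The Radon-Nikodym derivative with respect to Lebesgue measure and the Gaussian density have the
    same integral over every measurable set, hence agree almost everywhere. *)
Lemma ge0_integral_normal_prob (m : R) (f : mR -> \bar R) :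
  measurable_fun setT f -> (forall x, (0 <= f x)%E) ->
  (\int[normalP m]_x f x =
   \int[mu]_x (f x * (normal_pdf m 1 x)%:E))%E.
Proof.
move=> mf f0.
have dom := normal_prob_dominates m 1.
rewrite -(Radon_Nikodym_SigmaFinite.change_of_variables dom)//.
apply: ae_eq_integral => //.
- apply: emeasurable_funM => //.
  by apply: (measurable_int lebesgue_measure);
    exact: Radon_Nikodym_SigmaFinite.f_integrable.
- apply: emeasurable_funM => //; apply/measurable_EFinP.
  exact: measurable_normal_pdf.
- apply: ae_eqe_mul2l; apply: integral_ae_eq => //.
  + exact: Radon_Nikodym_SigmaFinite.f_integrable.
  + by apply/measurable_EFinP; exact: measurable_normal_pdf.
  + by move=> E _ mE; rewrite -Radon_Nikodym_SigmaFinite.f_integral.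
Qed.

(** The density of N(m, 1) with respect to N(0, 1). *)
Definition normal_lr1 (m x : R) : R := expR (m * x - m ^+ 2 / 2).

Lemma normal_pdf_lr (m x : R) :
  normal_pdf m 1 x = normal_pdf 0 1 x * normal_lr1 m x.
Proof.
rewrite !normal_pdfE ?oner_eq0// -mulrA; congr (_ * _).
by rewrite /normal_fun /normal_lr1 -expRD; congr expR; field.
Qed.

Lemma measurable_normal_lr1 (m : R) :
  measurable_fun setT (normal_lr1 m : mR -> mR).
Proof.
by apply: measurableT_comp => //; exact: measurable_funB.
Qed.

Lemma ge0_integral_normal_shift (m : R) (f : mR -> \bar R) :
  measurable_fun setT f -> (forall x, (0 <= f x)%E) ->
  (\int[normalP m]_x f x = \int[normalP 0]_x (f x * (normal_lr1 m x)%:E))%E.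
Proof.
move=> mf f0; rewrite !ge0_integral_normal_prob//.
- apply: eq_integral => x _; rewrite normal_pdf_lr -muleA -EFinM.
  by rewrite [in RHS]mulrC.
- apply: emeasurable_funM => //; apply/measurable_EFinP.
  exact: measurable_normal_lr1.
- by move=> x; rewrite mule_ge0// lee_fin expR_ge0.
Qed.

Definition normal_lr n (m : 'I_n -> R) (x : n.-tuple mR) : R :=
  \prod_i normal_lr1 (m i) (tnth x i).

Lemma measurable_normal_lr n (m : 'I_n -> R) :
  measurable_fun setT (normal_lr m : _ -> mR).
Proof.
apply: measurable_prod => i _.
apply: measurableT_comp; first exact: measurable_normal_lr1.
exact: measurable_tnth.
Qed.

Lemma normal_lr_ge0 n (m : 'I_n -> R) x : 0 <= normal_lr m x.
Proof. by rewrite prodr_ge0// => i _; exact: expR_ge0. Qed.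

Lemma normal_lr_tcons n (m : 'I_n.+1 -> R) (x : mR * n.-tuple mR) :
  normal_lr m (tcons x) =
  normal_lr1 (m ord0) x.1 * normal_lr (fun i => m (lift ord0 i)) x.2.
Proof.
rewrite /normal_lr big_ord_recl /=; congr (_ * _).
by apply: eq_bigr => i _; rewrite tnthS.
Qed.

End change_of_measure.

(** The product law is the image of a binary product under [tcons], so Tonelli splits off the first
    coordinate. *)
Lemma ge0_integral_product_prob d (T : measurableType d) (R : realType) n
    (P : 'I_n.+1 -> probability T R) (f : n.+1.-tuple T -> \bar R) :
  measurable_fun setT f -> (forall x, (0 <= f x)%E) ->
  (\int[product_prob P]_x f x = \int[P ord0]_x
     \int[product_prob (fun i => P (lift ord0 i))]_y f (tcons (x, y)))%E.
Proof.
move=> mf f0; rewrite ge0_integral_distribution// fubini_tonelli1//=.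
exact: measurableT_comp.
Qed.

Section normal_law_density.
Context (R : realType).
Local Notation mR := (measurableTypeR R).

(** Induction on [n]: the inner integral is handled by the induction hypothesis, the outer one by
    the one-dimensional shift, and the two ratios multiply to [normal_lr m]. *)
Lemma ge0_integral_normal_law n (m : 'I_n -> R)
    (f : n.-tuple mR -> \bar R) :
  measurable_fun setT f -> (forall x, (0 <= f x)%E) ->
  (\int[normal_law m]_x f x =
   \int[null_law R n]_x (f x * (normal_lr m x)%:E))%E.
Proof.
elim: n m f => [|n IH] m f mf f0.
  rewrite /null_law /normal_law /=; apply: eq_integral => x _.
  by rewrite /normal_lr big_ord0 mule1.
have mfl : measurable_fun setT (fun x => f x * (normal_lr m x)%:E)%E.
  by apply: emeasurable_funM => //; apply/measurable_EFinP;
    exact: measurable_normal_lr.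
have mtcons (x : mR) : measurable_fun setT (fun y : n.-tuple mR => tcons (x, y)).
  by apply: measurableT_comp => //; exact: pair1_measurable.
have fl0 x : (0 <= f x * (normal_lr m x)%:E)%E.
  by rewrite mule_ge0// lee_fin normal_lr_ge0.
rewrite [LHS](ge0_integral_product_prob _ mf f0).
rewrite [RHS](ge0_integral_product_prob _ mfl fl0).
rewrite ge0_integral_normal_shift.
- apply: eq_integral => x _ /=.
  rewrite [X in (X * _)%E]IH//; last exact: measurableT_comp.
  rewrite muleC -ge0_integralZl_EFin ?expR_ge0//.
  + by apply: eq_integral => y _; rewrite normal_lr_tcons EFinM muleCA.
  + by move=> y _; rewrite mule_ge0// lee_fin normal_lr_ge0.
  + apply: emeasurable_funM; first exact: measurableT_comp.
    by apply/measurable_EFinP; exact: measurable_normal_lr.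
- apply: (measurable_fun_fubini_tonelli_F (f \o @tcons _ _ n)) => //.
  exact: measurableT_comp.
- by move=> x; exact: f0.
- by move=> x; apply: integral_ge0.
Qed.

End normal_law_density.

(** * From the second moment of a likelihood ratio to a lower bound on testing error *)

(** The error is at least E min(1, L) = 1 - E|L - 1| / 2, and 2 t |L - 1| <= (L - 1)^2 + t^2 bounds
    E|L - 1| by t. The proof merges both steps into one pointwise inequality, arranged with
    nonnegative sides so that it can be integrated without integrability conditions. *)
Lemma ge0_integral_likelihood_bound d (T : measurableType d) (R : realType)
    (P : probability T R) (L : T -> R) (A : set T) (t : R) :
  0 < t -> measurable A -> measurable_fun setT L -> (forall x, 0 <= L x) ->
  (\int[P]_x (L x)%:E = 1)%E -> (\int[P]_x (L x ^+ 2)%:E <= (1 + t ^+ 2)%:E)%E ->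
  ((1 - t / 2)%:E <= P A + \int[P]_x (\1_(~` A) x * L x)%:E)%E.
Proof.
move=> t0 mA mL L0 L1 L2.
have mB : measurable (~` A) by exact: measurableC.
have mL2 : measurable_fun setT (fun x => (L x ^+ 2)%:E).
  by apply/measurable_EFinP; exact: measurable_funX.
have mBL : measurable_fun setT (fun x => (\1_(~` A) x * L x)%:E).
  by apply/measurable_EFinP; exact: measurable_funM.
have BL0 x : 0 <= \1_(~` A) x * L x by rewrite mulr_ge0.
have intc (c : R) : (\int[P]_x c%:E = c%:E)%E.
  rewrite integral_cst// [X in (_ * X)%E](_ : _ = 1%E) ?mule1//.
  exact: probability_setT.
set H := (P A + _)%E.
have intH : (\int[P]_x (\1_A x + \1_(~` A) x * L x)%:E = H)%E.
  under eq_integral do rewrite EFinD.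
  rewrite ge0_integralD//.
  - by rewrite integral_indic// setIT.
  - by apply/measurable_EFinP.
  - by move=> x _; rewrite lee_fin.
have H0 : (0 <= H)%E.
  by apply: adde_ge0 => //; apply: integral_ge0 => x _; rewrite lee_fin.
have h0 x : 0 <= \1_A x + \1_(~` A) x * L x by rewrite addr_ge0.
have mh : measurable_fun setT (fun x => (\1_A x + \1_(~` A) x * L x)%:E).
  by apply/measurable_EFinP; apply: measurable_funD => //; exact: measurable_funM.
(* On A and on its complement the difference of the two sides is
   (L - 1 - t)^2 and (L - 1 + t)^2 respectively. *)
have ptw x : 2 * t + (2 * t + 2) * L x <=
    4 * t * (\1_A x + \1_(~` A) x * L x) + L x ^+ 2 + (1 + t ^+ 2).
  rewrite !indicE; have [xA|xA] := pselect (A x).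
    rewrite mem_set// memNset; last by move=> /(_ xA).
    rewrite /= mulr1n mulr0n; by have := sqr_ge0 (L x - 1 - t); lra.
  rewrite memNset// mem_set//= mulr1n mulr0n.
  by have := sqr_ge0 (L x - 1 + t); lra.
have intl : (\int[P]_x (2 * t + (2 * t + 2) * L x)%:E = (4 * t + 2)%:E)%E.
  have E x : (2 * t + (2 * t + 2) * L x)%:E =
      ((2 * t)%:E + (2 * t + 2)%:E * (L x)%:E)%E by rewrite -EFinM -EFinD.
  under eq_integral do rewrite E.
  rewrite ge0_integralD//.
  - rewrite ge0_integralZl_EFin//; first last.
    + by rewrite addr_ge0// mulr_ge0// ltW.
    + exact/measurable_EFinP.
    + by move=> x _; rewrite lee_fin.
    by rewrite intc L1 mule1 -EFinD; congr (_%:E); lra.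
  - by move=> x _; rewrite lee_fin; lra.
  - by move=> x _; rewrite -EFinM lee_fin; have := L0 x; nra.
  - by apply: emeasurable_funM => //; exact/measurable_EFinP.
have intr : (\int[P]_x (4 * t * (\1_A x + \1_(~` A) x * L x)
      + L x ^+ 2 + (1 + t ^+ 2))%:E =
    (4 * t)%:E * H + \int[P]_x (L x ^+ 2)%:E + (1 + t ^+ 2)%:E)%E.
  have E x : (4 * t * (\1_A x + \1_(~` A) x * L x)
      + L x ^+ 2 + (1 + t ^+ 2))%:E =
      ((4 * t)%:E * (\1_A x + \1_(~` A) x * L x)%:E
      + (L x ^+ 2)%:E + (1 + t ^+ 2)%:E)%E by rewrite -EFinM -!EFinD.
  under eq_integral do rewrite E.
  have mh4 : measurable_fun setT
      (fun x => (4 * t)%:E * (\1_A x + \1_(~` A) x * L x)%:E)%E.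
    exact: emeasurable_funM.
  have h40 x : (0 <= (4 * t)%:E * (\1_A x + \1_(~` A) x * L x)%:E)%E.
    by rewrite -EFinM lee_fin mulr_ge0// mulr_ge0// ltW.
  have L20 x : (0 <= (L x ^+ 2)%:E)%E by rewrite lee_fin sqr_ge0.
  rewrite ge0_integralD//; first last.
  - by move=> x _; rewrite lee_fin addr_ge0// sqr_ge0.
  - exact: emeasurable_funD.
  - by move=> x _; exact: adde_ge0.
  rewrite ge0_integralD// ge0_integralZl_EFin//; first last.
  - by rewrite mulr_ge0// ltW.
  - by move=> x _; rewrite lee_fin.
  by rewrite intc intH.
have : (\int[P]_x (2 * t + (2 * t + 2) * L x)%:E <=
    \int[P]_x (4 * t * (\1_A x + \1_(~` A) x * L x)
      + L x ^+ 2 + (1 + t ^+ 2))%:E)%E.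
  apply: ge0_le_integral => //.
  - by move=> x _; rewrite lee_fin; have := L0 x; nra.
  - apply/measurable_EFinP; apply: measurable_funD => //.
    exact: measurable_funM.
  - by apply/measurable_EFinP; apply: measurable_funD => //;
      apply: measurable_funD; apply: measurable_funM => //;
      apply/measurable_EFinP.
  - by move=> x _; rewrite lee_fin.
rewrite intl intr.
have : (0 <= \int[P]_x (L x ^+ 2)%:E)%E.
  by apply: integral_ge0 => x _; rewrite lee_fin sqr_ge0.
(* The second moment is finite by [L2], and an infinite [H] is trivial. Otherwise 4 t + 2 <= 4 t h +
   l + 1 + t^2 with l <= 1 + t^2, and dividing by 4 t gives the claim. *)
move: L2; case: (\int[P]_x (L x ^+ 2)%:E)%E => [l||]//.
case: H H0 {intH intr} => [h| |] H0 l2 _; [|by rewrite leey|by []].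
rewrite -!EFinM -!EFinD !lee_fin in l2 *; nra.
Qed.

(** * Exponential moment of the overlap *)

Lemma expR_chord (R : realType) (a w : R) : 0 <= w <= 1 ->
  expR (w * a) <= 1 + w * (expR a - 1).
Proof.
move=> /andP[w0 w1].
have e0 := expR_gt0 (w * a).
(* The tangent to exp at [w * a] lies below exp at [a] and at [0]. *)
have ha : expR (w * a) * (1 + (a - w * a)) <= expR a.
  rewrite -[in leRHS](subrKC (w * a) a) expRD ler_pM2l//.
  exact: expR_ge1Dx.
have h0 : expR (w * a) * (1 - w * a) <= 1.
  rewrite -[leRHS](expRxMexpNx_1 (w * a)) ler_pM2l//.
  exact: expR_ge1Dx.
(* Weighting [ha] by [w] and [h0] by [1 - w] cancels the terms in w (1 - w) a. *)
by nra.
Qed.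

Section overlap_moments.
Context (R : realType) (n K : nat) (C : {set {set 'I_n}}).
Hypothesis sizeC : forall S : {set 'I_n}, S \in C -> #|S| = K.

Lemma pmf_prob_uniform (E : {set {set 'I_n}}) :
  pmf_prob (uniform_pmf R C) E = \sum_(S in C) (S \in E)%:R / #|C|%:R.
Proof.
rewrite /pmf_prob /uniform_pmf big_mkcond [RHS]big_mkcond/=.
apply: eq_bigr => S _.
by case: (S \in C) (S \in E) => [] []; rewrite ?mul1r ?mul0r.
Qed.

(** Double counting of the pairs (S, i) with i in both S and S0. *)
Lemma sum_cardsI (S0 : {set 'I_n}) :
  \sum_(S in C) #|S :&: S0|%:R =
  \sum_(i in S0) \sum_(S in C) (i \in S)%:R :> R.
Proof.
rewrite exchange_big/=; apply: eq_bigr => S _.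
rewrite -sum1_card natr_sum big_mkcond [RHS]big_mkcond/=.
by apply: eq_bigr => i _; rewrite inE; case: (i \in S) (i \in S0) => [] [].
Qed.

Hypothesis C0 : (0 < #|C|)%N.
Hypothesis K0 : (0 < K)%N.
Hypothesis unif : forall (S0 : {set 'I_n}) (i : 'I_n), S0 \in C -> i \in S0 ->
    pmf_prob (uniform_pmf R C) [set S : {set 'I_n} | i \in S] =
      K%:R / n%:R.

(** By (ii), each of the K elements of [S0] lies in #|C| K / n members of [C]. *)
Lemma sum_overlap (S0 : {set 'I_n}) : S0 \in C ->
  \sum_(S in C) #|S :&: S0|%:R = K%:R * (#|C|%:R * (K%:R / n%:R)) :> R.
Proof.
move=> S0C; rewrite sum_cardsI -{1}(sizeC S0C) mulr_natl -sumr_const.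
apply: eq_bigr => i iS0; rewrite -(unif S0C iS0) pmf_prob_uniform mulr_sumr.
apply: eq_bigr => S _; rewrite inE mulrCA divff ?mulr1// pnatr_eq0.
by rewrite -lt0n.
Qed.

Lemma sum_expR_overlap (a : R) :
  \sum_(S in C) \sum_(S' in C) expR (a * #|S :&: S'|%:R) <=
  #|C|%:R ^+ 2 * (1 + K%:R / n%:R * (expR (a * K%:R) - 1)).
Proof.
rewrite exchange_big/=.
rewrite expr2 -mulrA mulr_natl -sumr_const; apply: ler_sum => S' S'C.
have K0R : K%:R != 0 :> R by rewrite pnatr_eq0 -lt0n.
apply: (@le_trans _ _ (\sum_(S in C)
    (1 + #|S :&: S'|%:R / K%:R * (expR (a * K%:R) - 1)))).
  apply: ler_sum => S SC.
  (* The chord of exp from 0 to a K is used at the fraction w = #|S :&: S'| / K, which is at most 1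
     because #|S| = K. *)
  rewrite -[X in expR X <= _](_ : #|S :&: S'|%:R / K%:R * (a * K%:R) = _).
    apply: expR_chord; rewrite divr_ge0//= ler_pdivrMr ?ltr0n// mul1r ler_nat.
    by rewrite -(sizeC SC) subset_leq_card// subsetIl.
  by field.
rewrite big_split/= sumr_const -!mulr_suml sum_overlap//.
by rewrite [_ * (_ * _) / _]mulrAC divff// mul1r [leRHS]mulrDr mulr1 -!mulrA.
Qed.

End overlap_moments.

(** * The risk in terms of the mixture likelihood ratio, and its second moment *)

Section risk_bound.
Context (R : realType) (n : nat).
Local Notation mR := (measurableTypeR R).

Lemma measurable_EFin_normal_lr (m : 'I_n -> R) :
  measurable_fun setT (fun x : n.-tuple mR => (normal_lr m x)%:E).
Proof. by apply/measurable_EFinP; exact: measurable_normal_lr. Qed.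

(** Completing the square leaves the cross term m_i m'_i. The remaining factor is again a likelihood
    ratio, so it integrates to 1 under the null law. *)
Lemma normal_lrM (m m' : 'I_n -> R) x :
  normal_lr m x * normal_lr m' x =
  expR (\sum_i m i * m' i) * normal_lr (fun i => m i + m' i) x.
Proof.
rewrite /normal_lr expR_sum -!big_split /=; apply: eq_bigr => i _.
by rewrite /normal_lr1 -!expRD; congr expR; field.
Qed.

Lemma integral_normal_lr (m : 'I_n -> R) :
  (\int[null_law R n]_x (normal_lr m x)%:E = 1)%E.
Proof.
transitivity (\int[normal_law m]_x (cst 1 x : \bar R))%E.
  rewrite ge0_integral_normal_law//; apply: eq_integral => x _.
  by rewrite /= mul1e.
rewrite integral_cst// mul1e; exact: probability_setT.
Qed.

Lemma normal_law_lr (m : 'I_n -> R) (B : set (n.-tuple mR)) :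
  measurable B ->
  normal_law m B = (\int[null_law R n]_x (\1_B x * normal_lr m x)%:E)%E.
Proof.
move=> mB; transitivity (\int[normal_law m]_x (\1_B x)%:E)%E.
  by rewrite integral_indic// setIT.
rewrite ge0_integral_normal_law//; exact/measurable_EFinP.
Qed.

(** Coordinates outside [S] contribute a factor 1, so this is exp(mu x_S - #|S| mu^2 / 2), where x_S
    is the sum of x over [S]. *)
Definition planted_lr (mu : R) (S : {set 'I_n}) : n.-tuple mR -> R :=
  normal_lr (fun i => if i \in S then mu else 0).

Definition mixture_lr (C : {set {set 'I_n}}) (mu : R) (x : n.-tuple mR) : R :=
  #|C|%:R^-1 * \sum_(S in C) planted_lr mu S x.

Lemma planted_lrM (mu : R) (S S' : {set 'I_n}) x :
  planted_lr mu S x * planted_lr mu S' x = expR (mu ^+ 2 * #|S :&: S'|%:R) *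
  normal_lr (fun i => (if i \in S then mu else 0) +
    (if i \in S' then mu else 0)) x.
Proof.
rewrite /planted_lr normal_lrM; congr (expR _ * _).
rewrite -sum1_card natr_sum mulr_sumr [RHS]big_mkcond/=.
apply: eq_bigr => i _; rewrite inE.
by case: (i \in S) (i \in S') => [] []; rewrite ?mulr1 ?mulr0 ?mul0r.
Qed.

Variables (C : {set {set 'I_n}}) (mu : R).

Lemma mixture_lr_ge0 x : 0 <= mixture_lr C mu x.
Proof.
by rewrite mulr_ge0// sumr_ge0// => S _; exact: normal_lr_ge0.
Qed.

Lemma measurable_mixture_lr : measurable_fun setT (mixture_lr C mu : _ -> mR).
Proof.
apply: measurable_funM => //; under eq_fun do rewrite -big_enum.
by apply: measurable_sum => S; exact: measurable_normal_lr.
Qed.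

(** The weight [g] serves several uses: the constant 1 for the total mass, the indicator of the
    acceptance region for the risk, and the mixture ratio and then a planted ratio to expand the
    second moment. *)
Lemma integral_mixture_lrM (g : n.-tuple mR -> R) :
  measurable_fun setT g -> (forall x, 0 <= g x) ->
  (\int[null_law R n]_x (g x * mixture_lr C mu x)%:E =
  #|C|%:R^-1%:E *
    \sum_(S in C) \int[null_law R n]_x (g x * planted_lr mu S x)%:E)%E.
Proof.
move=> mg g0.
have mS S : measurable_fun setT (fun x => (g x * planted_lr mu S x)%:E).
  apply/measurable_EFinP; apply: measurable_funM => //.
  exact: measurable_normal_lr.
have S0 S x : (0 <= (g x * planted_lr mu S x)%:E)%E.
  by rewrite lee_fin mulr_ge0// normal_lr_ge0.
rewrite -big_enum/= -ge0_integral_sum// -ge0_integralZl_EFin//.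
- apply: eq_integral => x _.
  by rewrite sumEFin -EFinM big_enum /= -mulr_sumr mulrCA.
- by move=> x _; exact: sume_ge0.
- exact: emeasurable_sum.
Qed.

Lemma integral_mixture_lr : (0 < #|C|)%N ->
  (\int[null_law R n]_x (mixture_lr C mu x)%:E = 1)%E.
Proof.
move=> C0; transitivity
  (\int[null_law R n]_x (cst 1 x * mixture_lr C mu x)%:E)%E.
  by apply: eq_integral => x _; rewrite /= mul1r.
rewrite integral_mixture_lrM//.
under eq_bigr => S _ do under eq_integral do rewrite /= mul1r.
under eq_bigr => S _ do rewrite integral_normal_lr.
rewrite sumEFin -EFinM sumr_const -[X in _ * X]/(#|C|%:R) mulVf//.
by rewrite pnatr_eq0 -lt0n.
Qed.

Lemma integral_planted_lrM (S S' : {set 'I_n}) :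
  (\int[null_law R n]_x (planted_lr mu S x * planted_lr mu S' x)%:E =
   (expR (mu ^+ 2 * #|S :&: S'|%:R))%:E)%E.
Proof.
under eq_integral do rewrite planted_lrM EFinM.
rewrite ge0_integralZl_EFin ?expR_ge0//.
- by rewrite integral_normal_lr mule1.
- by move=> x _; rewrite lee_fin normal_lr_ge0.
- exact: measurable_EFin_normal_lr.
Qed.

Lemma integral_mixture_lr_sqr :
  (\int[null_law R n]_x (mixture_lr C mu x ^+ 2)%:E =
   (#|C|%:R^-1 ^+ 2 * \sum_(S in C) \sum_(S' in C)
     expR (mu ^+ 2 * #|S :&: S'|%:R))%:E)%E.
Proof.
under eq_integral do rewrite expr2.
rewrite integral_mixture_lrM//; last exact: mixture_lr_ge0.
  rewrite expr2 -mulrA (EFinM _ (_ * _)) mulr_sumr -sumEFin.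
  congr (_ * _)%E; apply: eq_bigr => S _.
  under eq_integral do rewrite mulrC.
  rewrite integral_mixture_lrM//.
  - rewrite EFinM -sumEFin; congr (_ * _)%E; apply: eq_bigr => S' _.
    exact: integral_planted_lrM.
  - exact: measurable_normal_lr.
  - exact: normal_lr_ge0.
exact: measurable_mixture_lr.
Qed.

Lemma measurable_rejection_region (f : {mfun n.-tuple mR >-> bool}) :
  measurable [set x | f x = true].
Proof. by apply: (measurable_funPTI f (Y := [set true])). Qed.

Lemma riskE (f : {mfun n.-tuple mR >-> bool}) (A := [set x | f x = true]) :
  risk C mu f = (null_law R n A +
    \int[null_law R n]_x (\1_(~` A) x * mixture_lr C mu x)%:E)%E.
Proof.
have mA : measurable A by exact: measurable_rejection_region.
have mB : measurable (~` A) by exact: measurableC.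
rewrite /risk; congr (_ + _)%E.
rewrite integral_mixture_lrM//; congr (_ * _)%E; apply: eq_bigr => S _.
rewrite (_ : [set x | f x = false] = ~` A); first exact: normal_law_lr.
by apply/seteqP; split => x; rewrite /A /=; case: (f x).
Qed.

(** The hypothesis on the double sum is E_0 L^2 <= 1 + t^2 multiplied by #|C|^2. *)
Lemma risk_ge (t : R) (f : {mfun n.-tuple mR >-> bool}) :
  0 < t -> (0 < #|C|)%N ->
  \sum_(S in C) \sum_(S' in C) expR (mu ^+ 2 * #|S :&: S'|%:R) <=
    #|C|%:R ^+ 2 * (1 + t ^+ 2) ->
  ((1 - t / 2)%:E <= risk C mu f)%E.
Proof.
move=> t0 C0 hC; rewrite riskE; apply: ge0_integral_likelihood_bound => //.
- exact: measurable_rejection_region.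
- exact: measurable_mixture_lr.
- exact: mixture_lr_ge0.
- exact: integral_mixture_lr.
- rewrite integral_mixture_lr_sqr lee_fin exprVn mulrC ler_pdivrMr.
    by rewrite mulrC.
  by rewrite exprn_gt0// ltr0n.
Qed.

End risk_bound.

(** * Matching the threshold on [mu] with the second-moment condition *)

Theorem proposition3p3 (R : realType) (n K : nat) (C : {set {set 'I_n}})
    (delta : R) :
  (1 <= #|C|)%N ->
  (1 <= K)%N ->
  (forall S : {set 'I_n}, S \in C -> #|S| = K) ->
  0 < delta < 1 ->
  (* (i): the law of Z given S' = A is the same for all A in C *)
  (forall A B : {set 'I_n}, A \in C -> B \in C -> forall z : nat,
    pmf_cond (pair_pmf R C) [set p | overlap p == z] [set p | p.2 == A] =
    pmf_cond (pair_pmf R C) [set p | overlap p == z] [set p | p.2 == B]) ->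
  (* (ii) *)
  (forall (S0 : {set 'I_n}) (i : 'I_n), S0 \in C -> i \in S0 ->
    pmf_prob (uniform_pmf R C) [set S : {set 'I_n} | i \in S] =
      K%:R / n%:R) ->
  forall mu : R, 0 < mu ->
    mu <= Num.sqrt (K%:R^-1 * ln (1 + 4 * n%:R * (1 - delta) ^+ 2 / K%:R)) ->
    (delta%:E <= optimal_risk C mu)%E.
Proof.
move=> C0 K0 sizeC /andP[d0 d1] _ unif mu mu0 hmu.
apply: le_ereal_inf_tmp => _ [f _ <-].
rewrite (_ : delta = 1 - (2 * (1 - delta)) / 2); last by field.
apply: risk_ge => //; first by rewrite mulr_gt0// subr_gt0.
apply: le_trans (sum_expR_overlap sizeC C0 K0 unif _) _.
have [S0 S0C] := card_gt0P C0.
have n0 : (0 < n%:R :> R).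
  rewrite ltr0n; apply: leq_trans K0 _.
  by rewrite -(sizeC _ S0C) -[X in (_ <= X)%N]card_ord max_card.
have K0R : 0 < K%:R :> R by rewrite ltr0n.
rewrite ler_pM2l ?exprn_gt0 ?ltr0n// lerD2l.
set y := 4 * n%:R * (1 - delta) ^+ 2 / K%:R in hmu.
have y0 : 0 <= y.
  by rewrite divr_ge0// mulr_ge0 ?sqr_ge0// mulr_ge0// ltW.
have ln0 : 0 <= ln (1 + y) by rewrite ln_ge0// lerDl.
(* This is the assumed bound on [mu], squared, multiplied by K and exponentiated. *)
have hexp : expR (mu ^+ 2 * K%:R) <= 1 + y.
  rewrite -[leRHS]lnK; last by rewrite posrE ltr_wpDr.
  rewrite ler_expR -ler_pdivlMr// mulrC.
  rewrite -[leRHS]sqr_sqrtr; last by rewrite mulr_ge0// invr_ge0.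
  by rewrite ler_pXn2r// nnegrE ?sqrtr_ge0// ltW.
(* The threshold is calibrated so that (K / n) y equals 4 (1 - delta)^2, which is exactly t^2. *)
apply: (@le_trans _ _ (K%:R / n%:R * y)).
  by rewrite ler_pM2l ?divr_gt0// lerBlDl.
rewrite le_eqVlt; apply/orP; left; apply/eqP; rewrite /y; field.
by rewrite !gt_eqF.
Qed.
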